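(* Let $G$ be a graph, not necessarily connected, with $v$ vertices. Let $\mathcal A$ be a $\mathbb Z$-algebra of degree less than or equal to $m-1$ satisfying the standing assumptions. If $H^{i,j}_{\mathcal A}(G)\neq 0$ then $(m-1)i+j\le (m-1)v$.
   Context: Graphs are finite and undirected, and may have loops and multiple edges. Standing assumptions on $\mathcal A$: $\mathcal A=\bigoplus_{i\ge 0}A_i$ is a commutative graded $\mathbb Z$-algebra with identity such that each $A_i$ is a free $\mathbb Z$-module of finite rank. A graded $\mathbb Z$-algebra is of degree less than or equal to $d$ if all its (nonzero) homogeneous elements have degree $\le d$. Here $m\ge1$ is an integer. Graph cohomology over $\mathcal A$: let $G$ be a graph with ordered edges $e_1,\dots,e_n$. For $s\subseteq E(G)$ let $[G:s]$ be the graph with vertex set $V(G)$ and edge set $s$, and let $C^{s}(G)=\mathcal A^{\otimes k}$ (tensor over $\mathbb Z$, one factor per connected component of $[G:s]$, $k$ being the number of components), with the induced grading. Put $C^i(G)=\bigoplus_{|s|=i}C^s(G)$. For $e\notin s$ the per-edge map $C^{s}(G)\to C^{s\cup\{e\}}(G)$ is the identity if $e$ joins a component of $[G:s]$ to itself; if $e$ joins two different components it multiplies the two corresponding tensor factors via $\mathcal A\otimes\mathcal A\to\mathcal A$ and is the identity on the other factors. The differential $d^i:C^i(G)\to C^{i+1}(G)$ is the sum of the per-edge maps over all $|s|=i$ and $e=e_r\notin s$, with sign $(-1)^{\#\{t<r:\ e_t\in s\}}$. It preserves degree; $H^{i,j}_{\mathcal A}(G)$ is the degree $j$ part of the $i$-th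 cohomology $H^i_{\mathcal A}(G)$. *)

(* Defs.v *)
From HB Require Import structures.
From mathcomp Require Import all_boot all_order all_algebra.
From mathcomp Require Import generic_quotient ring_quotient.
From mathcomp Require Import boolp.
From mathcomp.multinomials Require Import freeg.

Set Implicit Arguments.
Unset Strict Implicit.
Unset Printing Implicit Defensive.

Import GRing.Theory.
Local Open Scope ring_scope.
Local Open Scope quotient_scope.

Section Span.
Variables (V : zmodType) (P : V -> Prop).

Inductive in_zspan : V -> Prop :=
| zspan_gen x of P x : in_zspan x
| zspan_zero : in_zspan 0
| zspan_sub x y of in_zspan x & in_zspan y : in_zspan (x - y).

Definition zspan : {pred V} := fun x => `[< in_zspan x >].

Lemma zspanP x : reflect (in_zspan x) (x \in zspan).
Proof. exact: asboolP. Qed.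

Fact zspan_zmod_closed : zmod_closed zspan.
Proof.
split=> [|x y /zspanP xS /zspanP yS]; apply/zspanP; first exact: zspan_zero.
exact: zspan_sub.
Qed.

HB.instance Definition _ := GRing.isZmodClosed.Build V zspan zspan_zmod_closed.

End Span.

Section DirectSum.
Variables (I : finType) (T : I -> zmodType).

Definition dsum := {dffun forall i, T i}.
HB.instance Definition _ := Choice.on dsum.
Implicit Types f g : dsum.

Definition dsum_zero : dsum := [ffun i : I => (0 : T i)].
Definition dsum_opp f : dsum := [ffun i : I => - f i].
Definition dsum_add f g : dsum := [ffun i : I => f i + g i].

Fact dsum_addA : associative dsum_add.
Proof. by move=> f g h; apply/ffunP=> i; rewrite !ffunE addrA. Qed.
Fact dsum_addC : commutative dsum_add.
Proof. by move=> f g; apply/ffunP=> i; rewrite !ffunE addrC. Qed.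
Fact dsum_add0 : left_id dsum_zero dsum_add.
Proof. by move=> f; apply/ffunP=> i; rewrite !ffunE add0r. Qed.
Fact dsum_addN : left_inverse dsum_zero dsum_opp dsum_add.
Proof. by move=> f; apply/ffunP=> i; rewrite !ffunE addNr. Qed.

HB.instance Definition _ :=
  GRing.isZmodule.Build dsum dsum_addA dsum_addC dsum_add0 dsum_addN.

Lemma dsumE f g i : (f - g) i = f i - g i.
Proof. by rewrite !ffunE. Qed.

End DirectSum.

Section Graded.
Variable A : comPzRingType.

Definition free_of_finite_rank (S : zmodClosed A) :=
  exists (r : nat) (b : 'I_r -> A),
    (forall k, b k \in S) /\
    (forall a, a \in S -> exists! c : {ffun 'I_r -> int},
                 a = \sum_k b k *~ c k).

(* A Z-algebra is just a ring; [gr i] is the homogeneous part [A_i].  The two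
   sum conditions say that [A] is the internal direct sum of the [gr i]. *)
Record graded_algebra (gr : nat -> zmodClosed A) : Prop := GradedAlgebra {
  gr_one : 1 \in gr 0%N;
  gr_mul : forall i j a b, a \in gr i -> b \in gr j -> a * b \in gr (i + j)%N;
  gr_sum : forall a, exists (N : nat) (f : nat -> A),
    (forall i, f i \in gr i) /\ a = \sum_(i < N) f i;
  gr_direct : forall (N : nat) (f : nat -> A), (forall i, f i \in gr i) ->
    \sum_(i < N) f i = 0 -> forall i, (i < N)%N -> f i = 0;
  gr_free : forall i, free_of_finite_rank (gr i)
}.

Definition degree_le (gr : nat -> zmodClosed A) (d : nat) :=
  forall i a, a \in gr i -> a != 0 -> (i <= d)%N.

End Graded.

Section TensorPower.
Variables (A : comPzRingType) (K : finType).

Definition upd (a : {ffun K -> A}) (k : K) (x : A) : {ffun K -> A} :=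
  [ffun l => if l == k then x else a l].

Definition multilinear (M : zmodType) (f : {ffun K -> A} -> M) :=
  forall a k x y, f (upd a k (x + y)) = f (upd a k x) + f (upd a k y).

Definition tensor_rel (u : {freeg {ffun K -> A} / int}) :=
  exists a k x y,
    u = << upd a k (x + y) >> - << upd a k x >> - << upd a k y >>.

(* The tensor power of [A] with one factor for each [k : K]: the free abelian
   group on [K]-indexed families modulo additivity in each variable (which
   implies Z-multilinearity).  The record only keeps unification from unfolding
   the quotient. *)
Record tpow := TPow { tpow_val : Quotient.quot (zspan tensor_rel) }.
HB.instance Definition _ := [isNew for tpow_val].
HB.instance Definition _ := [Choice of tpow by <:].

Definition tpow_opp x := TPow (- tpow_val x).
Definition tpow_add x y := TPow (tpow_val x + tpow_val y).

Fact tpow_addA : associative tpow_add.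
Proof. by move=> x y z; rewrite /tpow_add addrA. Qed.
Fact tpow_addC : commutative tpow_add.
Proof. by move=> x y; rewrite /tpow_add addrC. Qed.
Fact tpow_add0 : left_id (TPow 0) tpow_add.
Proof. by case=> x; rewrite /tpow_add add0r. Qed.
Fact tpow_addN : left_inverse (TPow 0) tpow_opp tpow_add.
Proof. by move=> x; rewrite /tpow_add addNr. Qed.
HB.instance Definition _ :=
  GRing.isZmodule.Build tpow tpow_addA tpow_addC tpow_add0 tpow_addN.

Definition tpow_pi (u : {freeg {ffun K -> A} / int}) : tpow := TPow (\pi u).

Lemma tpow_pi_is_additive : zmod_morphism tpow_pi.
Proof. by move=> u v; rewrite /tpow_pi raddfB. Qed.

HB.instance Definition _ :=
  GRing.isZmodMorphism.Build {freeg {ffun K -> A} / int} tpow tpow_pi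
    tpow_pi_is_additive.

Lemma tpow_pi_eq u v : (tpow_pi u == tpow_pi v) = (u - v \in zspan tensor_rel).
Proof. by rewrite Quotient.idealrBE -val_eqE. Qed.

Lemma tpow_ind (P : tpow -> Prop) : (forall u, P (tpow_pi u)) -> forall x, P x.
Proof. by move=> piP [x]; rewrite -[x]reprK; apply: piP. Qed.

Definition tensor (a : {ffun K -> A}) : tpow := tpow_pi << a >>.

Lemma tensor_multilinear : multilinear tensor.
Proof.
move=> a k x y; rewrite /tensor -raddfD; apply/eqP.
rewrite tpow_pi_eq opprD addrA.
by apply/zspanP/zspan_gen; exists a, k, x, y.
Qed.

Variables (M : zmodType) (f : {ffun K -> A} -> M).

Definition freelift (u : {freeg {ffun K -> A} / int}) : M :=
  fglift (f : _ -> zmodule M) u.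

Lemma freelift_is_additive : zmod_morphism freelift.
Proof. by move=> u v; exact: (@lift_is_additive int _ (zmodule M) f u v). Qed.

Lemma freeliftU a : freelift << a >> = f a.
Proof. by rewrite /freelift liftU scale1r. Qed.

(* Meaningful only for multilinear [f]; see [tlift_tensor]. *)
Definition tlift (x : tpow) : M := freelift (repr (tpow_val x)).

Hypothesis f_ml : multilinear f.

Lemma freelift_rel u : u \in zspan tensor_rel -> freelift u = 0.
Proof.
have fB := freelift_is_additive.
move/zspanP; elim=> [_ [a [k [x [y ->]]]]||{}u v _ fu _ fv].
- by rewrite !fB !freeliftU f_ml [f _ + _]addrC addrK subrr.
- by rewrite -(subrr 0) fB subrr.
- by rewrite fB fu fv subrr.
Qed.

Lemma tlift_pi u : tlift (tpow_pi u) = freelift u.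
Proof.
apply/eqP; rewrite -subr_eq0 -freelift_is_additive; apply/eqP/freelift_rel.
by rewrite Quotient.idealrBE reprK.
Qed.

Lemma tlift_is_additive : zmod_morphism tlift.
Proof.
elim/tpow_ind=> u; elim/tpow_ind=> v; rewrite -raddfB !tlift_pi.
exact: freelift_is_additive.
Qed.

Lemma tlift_tensor a : tlift (tensor a) = f a.
Proof. by rewrite tlift_pi freeliftU. Qed.

End TensorPower.

Section TensorDegree.
Variables (A : comPzRingType) (gr : nat -> zmodClosed A) (K : finType).

Definition homogeneous_tensor (j : nat) (x : tpow A K) :=
  exists (a : {ffun K -> A}) (deg : K -> nat),
    [/\ forall k, a k \in gr (deg k), j = (\sum_k deg k)%N & x = tensor a].

Definition tpow_deg (j : nat) : {pred tpow A K} := zspan (homogeneous_tensor j).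
HB.instance Definition _ j := GRing.ZmodClosed.on (tpow_deg j).

End TensorDegree.

(* Edges are numbered; [ends e] lists the two (possibly equal) endpoints of [e]
   in an arbitrary order. *)
Record graph := Graph {
  vertex : finType;
  nedges : nat;
  ends : 'I_nedges -> vertex * vertex
}.

Section Components.
Variables (G : graph) (s : {set 'I_(nedges G)}).

Definition adjacent : rel (vertex G) := fun x y =>
  [exists e in s, (ends e == (x, y)) || (ends e == (y, x))].

(* Components of the spanning subgraph [G:s], as sets of vertices. *)
Definition components : {set {set vertex G}} :=
  equivalence_partition (connect adjacent) [set: vertex G].

Definition component := {C : {set vertex G} | C \in components}.

Lemma adjacent_connect_sym : connect_sym adjacent.
Proof.
apply: sym_connect_sym => x y.
by apply: eq_existsb => e; rewrite orbC.
Qed.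

Definition class_of (x : vertex G) : {set vertex G} :=
  [set y | connect adjacent x y].

Lemma class_of_component x : class_of x \in components.
Proof. by apply/imsetP; exists x => //; apply/setP=> y; rewrite !inE. Qed.

Lemma componentP (C : component) : exists x, val C = class_of x.
Proof.
case: C => C /= /imsetP[x _ ->]; exists x.
by apply/setP=> y; rewrite !inE.
Qed.

Lemma class_of_eq x y : x \in class_of y -> class_of y = class_of x.
Proof.
rewrite !inE => yx; apply/setP=> z; rewrite !inE.
by rewrite (same_connect adjacent_connect_sym yx).
Qed.

End Components.

Section Cochains.
Variables (A : comPzRingType) (G : graph).
Local Notation E := 'I_(nedges G).

(* For [t = e |: s] with [e \notin s], each component of [G:t] is either a
   component of [G:s] or the union of the two that [e] joins, so the product
   over the components of [G:s] inside [D] has one or two factors: [fuse] is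
   the per-edge map, the identity when [e] joins a component to itself. *)
Definition fuse_family (s t : {set E}) (a : {ffun component s -> A}) :
    {ffun component t -> A} :=
  [ffun D : component t => \prod_(C : component s | val C \subset val D) a C].

Definition fuse (s t : {set E}) :
    tpow A (component s) -> tpow A (component t) :=
  tlift (fun a => tensor (fuse_family t a)).

Definition edge_sets (i : nat) := {s : {set E} | #|s| == i}.

Definition cochain (i : nat) :=
  dsum (fun s : edge_sets i => tpow A (component (val s))).

Definition differential (i : nat) (x : cochain i) : cochain i.+1 :=
  [ffun t : edge_sets i.+1 =>
    \sum_(s : edge_sets i)
      \sum_(e | (e \notin val s) && (val t == e |: val s))
        fuse (val t) (x s) *~ (-1) ^+ #|[set u in val s | (u < e)%N]|].

Lemma component_super (s t : {set E}) (C : component s) : s \subset t ->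
  exists D : component t, forall D' : component t,
    (val C \subset val D') = (D' == D).
Proof.
move=> /subsetP st; have [x Cx] := componentP C.
exists (Sub (class_of t x) (class_of_component t x)) => D'.
apply/idP/eqP=> [/subsetP CD'|-> /=]; rewrite ?Cx.
  apply/val_inj=> /=; have [y D'y] := componentP D'.
  by rewrite D'y; apply: class_of_eq; rewrite -D'y CD' // Cx inE connect0.
apply/subsetP=> y; rewrite !inE; apply: connect_sub => {Cx}x {}y.
by move=> /existsP[e /andP[/st et xy]]; apply/connect1/existsP; exists e; rewrite et.
Qed.

Lemma fuse_multilinear (s t : {set E}) : s \subset t ->
  multilinear (fun a => tensor (fuse_family (s := s) t a)).
Proof.
move=> st a k x y; have [D kD] := component_super k st.
pose c := \prod_(C : component s | (val C \subset val D) && (C != k)) a C.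
have fuse_upd z :
    fuse_family t (upd a k z) = upd (fuse_family t a) D (z * c).
  apply/ffunP=> D'; rewrite !ffunE; case: eqP => [->|/eqP nD].
    rewrite (bigD1 k) ?kD //= ffunE eqxx; congr (_ * _).
    by apply: eq_bigr => C /andP[_ /negPf nC]; rewrite ffunE nC.
  apply: eq_bigr => C CD'; rewrite ffunE; case: eqP => // Ck.
  by rewrite -kD -Ck CD' in nD.
pose g z := tensor (fuse_family t (upd a k z)).
pose h z := tensor (upd (fuse_family t a) D z).
have gh z : g z = h (z * c) by rewrite /g fuse_upd.
have hD u v : h (u + v) = h u + h v by exact: tensor_multilinear.
change (g (x + y) = g x + g y); move: (g) (h) gh hD => g' h' gh hD.
by rewrite !gh mulrDl hD.
Qed.

Lemma fuse_is_additive (s t : {set E}) : s \subset t ->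
  zmod_morphism (@fuse s t).
Proof. by move=> st; apply/tlift_is_additive/fuse_multilinear. Qed.

Lemma fuse_tensor (s t : {set E}) a : s \subset t ->
  fuse t (tensor a : tpow A (component s)) = tensor (fuse_family t a).
Proof. by move=> st; apply/tlift_tensor/fuse_multilinear. Qed.

Lemma differential_is_additive i : zmod_morphism (@differential i).
Proof.
move=> x y; apply/ffunP=> t; rewrite !ffunE -sumrB; apply: eq_bigr => s _.
rewrite -sumrB; apply: eq_bigr => e /andP[_ /eqP te].
by rewrite !ffunE fuse_is_additive ?mulrzBl // te subsetUr.
Qed.

HB.instance Definition _ i :=
  GRing.isZmodMorphism.Build (cochain i) (cochain i.+1)
    (@differential i) (@differential_is_additive i).

Definition cocycle_pred (i : nat) : {pred cochain i} :=
  fun x => differential x == 0.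

Fact cocycle_zmod_closed i : zmod_closed (@cocycle_pred i).
Proof.
split=> [|x y /eqP dx /eqP dy]; apply/eqP; first exact: raddf0.
by rewrite differential_is_additive dx dy subrr.
Qed.
HB.instance Definition _ i :=
  GRing.isZmodClosed.Build (cochain i) (@cocycle_pred i)
    (@cocycle_zmod_closed i).

Record cocycle (i : nat) := Cocycle {
  cocycle_val :> cochain i;
  _ : cocycle_val \in @cocycle_pred i
}.
HB.instance Definition _ i := [isSub for @cocycle_val i].
HB.instance Definition _ i := [Choice of cocycle i by <:].
HB.instance Definition _ i := [SubChoice_isSubZmodule of cocycle i by <:].

Definition coboundary (i : nat) : {pred cocycle i} :=
  match i with
  | 0 => fun z => z == 0
  | i'.+1 => fun z => `[< exists y : cochain i', val z = differential y >]
  end.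

Fact coboundary_zmod_closed i : zmod_closed (@coboundary i).
Proof.
case: i => [|i]; split=> [|x y]; rewrite ?inE ?unfold_in //=.
- by move=> /eqP -> /eqP ->; rewrite subrr.
- by apply/asboolP; exists 0; rewrite raddf0.
move=> /asboolP[x' dx] /asboolP[y' dy]; apply/asboolP; exists (x' - y').
by rewrite differential_is_additive -dx -dy.
Qed.
HB.instance Definition _ i :=
  GRing.isZmodClosed.Build (cocycle i) (@coboundary i)
    (@coboundary_zmod_closed i).

Definition cohomology (i : nat) := Quotient.quot (@coboundary i).

Variable gr : nat -> zmodClosed A.

(* The differential preserves degree, so the degree [j] part of the cohomology
   consists of the classes of the cocycles that are homogeneous of degree [j]. *)
Definition cochain_deg (i j : nat) : {pred cochain i} :=
  [pred x : cochain i | [forall s, x s \in tpow_deg gr j]].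

Definition cohomology_deg (i j : nat) : {pred cohomology i} := fun h =>
  `[< exists2 z : cocycle i, val z \in @cochain_deg i j & h = \pi z >].

End Cochains.

(* Main.v *)
(* Deletion-contraction. For an edge [e] that is not a loop, the cochains
   supported on edge sets containing [e] form the complex of [G/e], shifted by
   one, and the quotient is the complex of [G - e]; passing to [G/e] lowers both
   [i] and [v] by one, so the bound follows by induction on the number of edges.
   When [e] is a loop the two pieces are identified by the per-edge map of [e]
   and the complex is acyclic. Without edges, [j <= (m - 1) v] because a tensor
   of larger degree has a factor of degree at least [m], which vanishes.
   Contracted graphs are not constructed: the induction runs over the intervals
   [S, T] of edge sets of the fixed graph [G]. *)
Require Import Defs.
From HB Require Import structures.
From mathcomp Require Import all_boot all_order all_algebra.
From mathcomp Require Import generic_quotient ring_quotient.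
From mathcomp Require Import boolp.
From mathcomp.multinomials Require Import freeg.

Set Implicit Arguments.
Unset Strict Implicit.
Unset Printing Implicit Defensive.

Import GRing.Theory.
Local Open Scope ring_scope.

(** * Tensor powers: vanishing tensors and degree bounds *)

Section TensorPowers.
Variables (A : comPzRingType) (K : finType).

Lemma tpow_additive_ext (M : zmodType) (f g : {additive tpow A K -> M}) :
  (forall a, f (tensor a) = g (tensor a)) -> f =1 g.
Proof.
move=> fg; apply: tpow_ind; apply: freeg_ind_dom0 => [|k a u _ _ IH].
  by rewrite !raddf0.
by rewrite -[k]intz -freegU_mulz !raddfD !raddfMz fg IH.
Qed.

Lemma tensor_eq0 (a : {ffun K -> A}) k : a k = 0 -> tensor a = 0.
Proof.
move=> ak0; have a_upd : upd a k 0 = a.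
  by apply/ffunP=> l; rewrite ffunE; case: eqP => // ->.
have := tensor_multilinear a k 0 0.
by rewrite addr0 a_upd -{1}[tensor a]addr0 => /addrI.
Qed.

Lemma tpow_deg_gt gr d j (x : tpow A K) : degree_le gr d ->
  (d * #|K| < j)%N -> x \in tpow_deg gr j -> x = 0.
Proof.
move=> grd dj /zspanP; elim=> {x} // [_ [a [deg [agr jE ->]]]|x y _ -> _ ->].
  case: (boolP [exists k, a k == 0]) => [/existsP[k /eqP]|/existsPn a_neq0].
    exact: tensor_eq0.
  suff: (j <= d * #|K|)%N by rewrite leqNgt dj.
  rewrite mulnC -sum_nat_const jE leq_sum // => k _.
  exact: grd (agr k) (a_neq0 k).
by rewrite subrr.
Qed.

End TensorPowers.

(** * Per-edge maps: composition, degree and invertibility *)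

Section Fuse.
Variables (A : comPzRingType) (G : graph).
Local Notation E := 'I_(nedges G).
Implicit Types (s t u : {set E}) (e : E).

Definition fuse_additive s t (st : s \subset t) :
    {additive tpow A (component s) -> tpow A (component t)} :=
  HB.pack (fuse (A := A) (s := s) t)
    (GRing.isZmodMorphism.Build _ _ _ (@fuse_is_additive A G s t st)).

Lemma component_refines s (C D : component s) :
  (val C \subset val D) = (D == C).
Proof.
have [D' CD'] := component_super C (subxx s).
by rewrite CD'; have /[!CD']/eqP-> := subxx (val C).
Qed.

(** On pure tensors both sides multiply, for each [D], the factors of all components of [s] inside
    [D]: each [C] lies in exactly one component [h C] of [t], so grouping by these changes
    nothing. *)
Lemma fuse_fuse s t u (x : tpow A (component s)) :
  s \subset t -> t \subset u -> fuse u (fuse t x) = fuse u x.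
Proof.
move=> st tu; have su := subset_trans st tu.
pose f := fuse_additive tu \o fuse_additive st.
apply: (@tpow_additive_ext _ _ _ f (fuse_additive su)) => a /=.
rewrite !fuse_tensor //; congr tensor; apply/ffunP=> D; rewrite !ffunE.
have /fin_all_exists[h hP] := fun C : component s => component_super C st.
under eq_bigr do rewrite ffunE.
rewrite (exchange_big_dep xpredT) //= [RHS]big_mkcond; apply: eq_bigr => C _.
have [D' CD'] := component_super C su.
under eq_bigl => B do rewrite hP andbC.
rewrite big_mkcondr big_pred1_eq; congr (if _ then _ else _).
have [D'' hD''] := component_super (h C) tu; rewrite hD'' CD'.
suff -> : D'' = D' by [].
apply/eqP; rewrite -CD' (subset_trans (_ : _ \subset val (h C))) ?hP //.
by rewrite hD''.
Qed.

Lemma tpow_deg_fuse gr s t j x : graded_algebra gr -> s \subset t ->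
  x \in tpow_deg gr j -> fuse (A := A) (s := s) t x \in tpow_deg gr j.
Proof.
move=> grA st; rewrite -[fuse t]/(fuse_additive st : _ -> _).
move=> /zspanP; elim=> {x} [_ [a [deg [agr jE ->]]]||x y _ xP _ yP].
- rewrite /= fuse_tensor //; apply/zspanP/zspan_gen.
  (* Merged factors add their degrees, and every [C] lies in exactly one [D], so the total is still
     [j]. *)
  pose deg' (D : component t) :=
    (\sum_(C : component s | val C \subset val D) deg C)%N.
  exists (fuse_family t a), deg'; split=> // [D|].
    rewrite ffunE /deg'.
    elim/big_rec2: _ => [|C i b _]; first exact: gr_one.
    exact/gr_mul.
  rewrite jE /deg' (exchange_big_dep xpredT) //=; apply: eq_bigr => C _.
  have [D CD] := component_super C st.
  by rewrite (eq_bigl _ _ CD) big_pred1_eq.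
- by rewrite raddf0 rpred0.
- by rewrite raddfB rpredB.
Qed.

(** The family underlying [fuse], with the sets of components abstracted to [K] and [K']: an
    equality [components s = components t] can then be eliminated by [case] despite the dependent
    types. *)
Definition set_fuse_family (V : finType) (K K' : {set {set V}})
    (a : {ffun {C | C \in K} -> A}) : {ffun {D | D \in K'} -> A} :=
  [ffun D : {D | D \in K'} =>
     \prod_(C : {C | C \in K} | val C \subset val D) a C].

Definition set_fuse (V : finType) (K K' : {set {set V}}) :
    tpow A {C | C \in K} -> tpow A {D | D \in K'} :=
  tlift (fun a => tensor (set_fuse_family K' a)).

Lemma set_fuse_id (V : finType) (K : {set {set V}}) :
    (forall C D : {C | C \in K}, (val C \subset val D) = (D == C)) ->
  set_fuse (K := K) K =1 id.
Proof.
move=> antiK; have idE (a : {ffun {C | C \in K} -> A}) :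
    set_fuse_family K a = a.
  apply/ffunP=> D; rewrite ffunE (eq_bigl (pred1 D)) ?big_pred1_eq // => C.
  by rewrite antiK eq_sym.
have ml : multilinear (fun a => tensor (set_fuse_family (K := K) K a)).
  by move=> a k x y; rewrite !idE; apply: tensor_multilinear.
pose f : {additive _ -> _} :=
  HB.pack (set_fuse (K := K) K)
    (GRing.isZmodMorphism.Build _ _ _ (tlift_is_additive ml)).
apply: (@tpow_additive_ext _ _ _ f idfun) => a.
by rewrite /= /set_fuse tlift_tensor // idE.
Qed.

Lemma fuse_id s (x : tpow A (component s)) : fuse s x = x.
Proof. by apply: set_fuse_id; apply: component_refines. Qed.

(** No inclusion between [s] and [t] is assumed, so [fuse] may also run downwards: it inverts the
    per-edge map of an edge that joins a component to itself. *)
Lemma fuse_eq_components s t (x : tpow A (component s)) :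
  components s = components t -> fuse s (fuse t x) = x.
Proof.
move=> st; change (set_fuse (components s) (set_fuse (components t) x) = x).
by case: _ / st; rewrite !set_fuse_id //; apply: component_refines.
Qed.

Lemma tpow_deg_fuse_eq gr s t j (x : tpow A (component s)) :
  components s = components t ->
  x \in tpow_deg gr j -> fuse t x \in tpow_deg gr j.
Proof.
move=> st xj; change (set_fuse (components t) x \in tpow_deg gr j).
by case: _ / st; rewrite set_fuse_id //; apply: component_refines.
Qed.

End Fuse.

(** * Components when an edge is added *)

Section ComponentCounts.
Variable G : graph.
Local Notation E := 'I_(nedges G).
Implicit Types (s t : {set E}) (e : E).

Lemma connect_adjacentS s t : s \subset t ->
  subrel (connect (adjacent (G := G) s)) (connect (adjacent t)).
Proof.
move=> /subsetP st x y; apply: connect_sub => {}x {}y.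
move=> /existsP[e /andP[/st et xy]]; apply/connect1/existsP.
by exists e; rewrite et.
Qed.

Lemma connect_adjacentU1 s e :
  connect (adjacent (e |: s)) (ends e).1 (ends e).2.
Proof.
apply/connect1/existsP; exists e.
by rewrite setU11 -surjective_pairing eqxx.
Qed.

(** Any use of [e] in a path can be replaced by a path inside [s]. *)
Lemma components_loop s t e : s \subset t ->
    connect (adjacent s) (ends e).1 (ends e).2 ->
  components (e |: t) = components t.
Proof.
move=> st /(connect_adjacentS st) loop.
suff same : connect (adjacent (e |: t)) =2 connect (adjacent t).
  by apply: eq_imset => x; apply/setP=> y; rewrite !inE same.
move=> x y; apply/idP/idP; last exact/connect_adjacentS/subsetUr.
apply: connect_sub => {}x {}y /existsP[f /andP[/setU1P[->|ft] xy]]; last first.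
  by apply/connect1/existsP; exists f; rewrite ft.
have loopC := loop; rewrite adjacent_connect_sym in loopC.
by case/orP: xy loop loopC => /eqP->.
Qed.

(** Sending the component of [z] in [s] to its component in [e |: s] is onto, and stays onto without
    the component of one endpoint of [e], since that of the other endpoint has the same image. *)
Lemma card_components_join s e :
    ~~ connect (adjacent s) (ends e).1 (ends e).2 ->
  (#|components (e |: s)| < #|components s|)%N.
Proof.
set x := (ends e).1; set y := (ends e).2; set t := e |: s => xy.
(* The default [x] is reached only for empty [C], and components are nonempty. *)
pose F (C : {set vertex G}) := class_of t (odflt x [pick z in C]).
have FE z : F (class_of s z) = class_of t z.
  rewrite /F; case: pickP => [z' /=|/(_ z)]; rewrite inE ?connect0 // => zz'.
  apply/esym/class_of_eq; rewrite inE.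
  exact: connect_adjacentS (subsetUr _ _) _ _ zz'.
have sx : class_of s x \in components s by apply: class_of_component.
rewrite (cardsD1 (class_of s x) (components s)) sx ltnS.
apply: leq_trans (leq_imset_card F _); apply/subset_leq_card/subsetP=> D Dt.
have [z /= ->] := componentP (Sub D Dt : component t).
have [zx|zx] := eqVneq (class_of s z) (class_of s x).
  apply/imsetP; exists (class_of s y).
    rewrite !inE class_of_component andbT; apply: contra xy => /eqP yx.
    have : y \in class_of s x by rewrite -yx inE connect0.
    by rewrite inE.
  rewrite -FE zx !FE; apply: class_of_eq; rewrite inE.
  exact: connect_adjacentU1.
apply/imsetP; exists (class_of s z); rewrite ?FE //.
by rewrite !inE zx class_of_component.
Qed.

Lemma card_components s : (#|components (G := G) s| <= #|vertex G|)%N.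
Proof. by rewrite -[X in (_ <= X)%N]cardsT leq_imset_card. Qed.

End ComponentCounts.

(** * The total complex and its differential *)

Section TotalComplex.
Variables (A : comPzRingType) (G : graph).
Local Notation E := 'I_(nedges G).
Implicit Types (s t u S T : {set E}) (e f : E).

(* All cochains at once, indexed by edge sets of any cardinality: this keeps
   the cohomological degree out of the types. *)
Definition total_cochain := dsum (fun s : {set E} => tpow A (component s)).
HB.instance Definition _ := GRing.Zmodule.on total_cochain.
Implicit Types x y w : total_cochain.

Definition edge_sign t e : int := (-1) ^+ #|[set u in t | (u < e)%N]|.

Lemma edge_sign_sqr t e : edge_sign t e * edge_sign t e = 1.
Proof. by rewrite /edge_sign -exprD addnn -signr_odd odd_double. Qed.

Lemma edge_signD1 t e f : e \in t ->
  edge_sign (t :\ e) f = edge_sign t f * (-1) ^+ (e < f)%N.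
Proof.
move=> et; rewrite /edge_sign (cardsD1 e [set u in t | _]) inE et /=.
have -> : [set u in t | (u < f)%N] :\ e = [set u in t :\ e | (u < f)%N].
  by apply/setP=> u; rewrite !inE andbA.
rewrite exprD mulrC mulrA -exprD addnn.
by rewrite -[X in _ = X * _]signr_odd odd_double mul1r.
Qed.

Definition tdiff x : total_cochain :=
  [ffun t : {set E} =>
     \sum_(e in t) fuse t (x (t :\ e)) *~ edge_sign t e
       : tpow A (component t)].

Lemma tdiff_is_additive : zmod_morphism tdiff.
Proof.
move=> x y; apply/ffunP=> t; rewrite !ffunE -sumrB; apply: eq_bigr => e _.
by rewrite !ffunE fuse_is_additive ?subsetDl // mulrzBl.
Qed.
HB.instance Definition _ :=
  GRing.isZmodMorphism.Build total_cochain total_cochain tdiff tdiff_is_additive.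

Lemma totalB x y s : (x - y) s = x s - y s.
Proof. by rewrite !ffunE. Qed.

Lemma fuse0 s t : s \subset t -> fuse t (0 : tpow A (component s)) = 0.
Proof. by move=> st; rewrite -[LHS]/(fuse_additive A st 0) raddf0. Qed.

Lemma fuseMz s t (z : tpow A (component s)) n : s \subset t ->
  fuse t (z *~ n) = fuse t z *~ n.
Proof. by move=> st; rewrite -[LHS]/(fuse_additive A st _) raddfMz. Qed.

Lemma tdiff_eq0 y t : (forall s, s \subset t -> y s = 0) -> tdiff y t = 0.
Proof.
move=> y0; rewrite ffunE big1 // => e _.
by rewrite y0 ?fuse0 ?subsetDl // mul0rz.
Qed.

Lemma tdiff1 y t e : e \in t ->
    (forall f, f \in t -> f != e -> y (t :\ f) = 0) ->
  tdiff y t = fuse t (y (t :\ e)) *~ edge_sign t e.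
Proof.
move=> et y0; rewrite ffunE (bigD1 e) //= big1 ?addr0 // => f /andP[ft fe].
by rewrite y0 // fuse0 ?subsetDl // mul0rz.
Qed.

Lemma tdiff_deg gr j y : graded_algebra gr ->
  (forall s, y s \in tpow_deg gr j) -> forall t, tdiff y t \in tpow_deg gr j.
Proof.
move=> grA yj t; rewrite ffunE; apply: rpred_sum => e _.
by apply: rpredMz; apply: tpow_deg_fuse (yj _); rewrite ?subsetDl. 
Qed.

(** Removing two edges in either order gives the same value with opposite signs ([HC]), so the terms
    cancel in pairs. *)
Lemma tdiff_tdiff x : tdiff (tdiff x) = 0.
Proof.
apply/ffunP=> t; rewrite !ffunE.
pose H e f := fuse t (x (t :\: [set e; f])) *~
  (edge_sign t e * edge_sign t f * (-1) ^+ (e < f)%N).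
have HC e f : e != f -> H e f = - H f e.
  move=> ef; rewrite /H setUC -mulrNz [edge_sign t e * _]mulrC -mulrN.
  by rewrite neq_ltn in ef; case: ltngtP ef => //= _ _; rewrite ?opprK.
transitivity (\sum_(e in t) \sum_(f in t | f != e) H e f).
  apply: eq_bigr => e et; rewrite ffunE.
  rewrite -[fuse t]/(fuse_additive A (subsetDl _ _) : _ -> _).
  rewrite raddf_sum mulrz_suml /=.
  apply: eq_big => [f|f]; rewrite !inE 1?andbC // => /andP[ft fe].
  rewrite fuseMz ?subsetDl // fuse_fuse ?subsetDl // -mulrzA.
  by rewrite setDDl edge_signD1 // mulrC mulrA.
transitivity (\sum_(e in t) \sum_(f in t | (e < f)%N) H e f +
              \sum_(e in t) \sum_(f in t | (f < e)%N) H e f).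
  rewrite -big_split; apply: eq_bigr => e _ /=.
  rewrite (bigID (fun f : E => (e < f)%N)) /=; congr (_ + _).
    apply: eq_bigl => f; rewrite -andbA; congr (_ && _).
    by rewrite -val_eqE /= neq_ltn; case: ltngtP.
  apply: eq_bigl => f; rewrite -andbA; congr (_ && _).
  by rewrite -val_eqE /= neq_ltn; case: ltngtP.
rewrite [X in _ + X](exchange_big_dep (mem t)) /=; last by move=> ? ? _ /andP[].
rewrite -big_split big1 // => e et /=.
rewrite [X in _ + X](eq_big (fun f => (f \in t) && (e < f)%N)
  (fun f => - H e f)); first by rewrite sumrN subrr.
  by move=> f; rewrite (et : e \in t). 
move=> f /and3P[_ _ ef]; apply: HC.
by rewrite -val_eqE /= neq_ltn ef orbT.
Qed.

End TotalComplex.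

(** * Exactness of the interval complexes in high degree *)

Section Exactness.
Variables (A : comPzRingType) (gr : nat -> zmodClosed A) (G : graph).
Variables (d i j : nat).
Hypotheses (grA : graded_algebra gr) (grd : degree_le gr d).
Hypothesis (ij_gt : (d * #|vertex G| < d * i + j)%N).
Local Notation E := 'I_(nedges G).
Local Notation total_cochain := (total_cochain A G).
Implicit Types (s t u S T : {set E}) (e f : E) (x y w : total_cochain).

(* The sets between [S] and [T] span a subquotient complex, the cochain complex
   of the graph with edges [T :\: S] contracted along [S]; [cocycle_on] and
   [bounds_on] express cocycles and coboundaries of this complex through
   representatives in the total_cochain complex. *)
Definition cocycle_on S T x :=
  [/\ forall s, x s \in tpow_deg gr j,
      forall s, s \subset T -> ~~ ((S \subset s) && (#|s| == i)) -> x s = 0 &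
      forall t, t \subset T -> tdiff x t = 0].

Definition bounds_on S T x y :=
  [/\ forall s, y s \in tpow_deg gr j,
      forall s, ~~ [&& S \subset s, s \subset T & #|s|.+1 == i] -> y s = 0 &
      forall t, t \subset T -> x t = tdiff y t].

(** The witness [y] applies the inverse of the per-edge map of [e] to the values of [x] at sets
    containing [e]. Then [x - tdiff y] vanishes at these sets, and the cocycle condition at [e |: t]
    forces it to vanish at [t] as well. *)
Lemma bounds_on_loop S T x e : e \in T -> e \notin S -> S \subset T ->
    connect (adjacent S) (ends e).1 (ends e).2 ->
  cocycle_on S T x -> exists y, bounds_on S T x y.
Proof.
move=> eT eS ST loop [xj x0 dx0].
have loopE t : S \subset t -> components (e |: t) = components t.
  by move=> St; apply: components_loop St loop.
have sub_rem t : S \subset t -> S \subset t :\ e.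
  by move=> St; rewrite subsetD1 St.
pose supp s := [&& S \subset s, s \subset T, e \notin s & #|s|.+1 == i].
pose y : total_cochain := [ffun s : {set E} =>
  (if supp s then fuse s (x (e |: s)) *~ edge_sign (e |: s) e else 0)
    : tpow A (component s)].
have yN s : ~~ supp s -> y s = 0 by rewrite ffunE => /negPf->.
have yj s : y s \in tpow_deg gr j.
  rewrite ffunE; case: ifP => [/and4P[Ss _ _ _]|_]; last exact: rpred0.
  by apply: rpredMz; apply: tpow_deg_fuse_eq (xj _); rewrite loopE.
have y_off t f : e \in t -> f \in t -> f != e -> y (t :\ f) = 0.
  by move=> et _ fe; apply: yN; rewrite /supp !inE et eq_sym fe !andbF.
have dyE t : t \subset T -> e \in t -> tdiff y t = x t.
  move=> tT et; rewrite (tdiff1 et) => [|f]; last exact: y_off.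
  have [St|St] := boolP (S \subset t); last first.
    rewrite x0 ?(negPf St) // yN ?fuse0 ?subsetDl ?mul0rz //.
    by rewrite /supp subsetD1 (negPf St).
  have [ti|ti] := boolP (#|t| == i); last first.
    rewrite x0 ?(negPf ti) ?andbF // yN ?fuse0 ?subsetDl ?mul0rz //.
    rewrite (cardsD1 e) et add1n in ti.
    by rewrite /supp (negPf ti) !andbF.
  rewrite ffunE /supp sub_rem // (subset_trans (subsetDl _ _)) // setD11.
  rewrite (cardsD1 e) et add1n in ti; rewrite ti /= setD1K //.
  rewrite fuseMz ?subsetDl // -mulrzA edge_sign_sqr mulr1z fuse_eq_components //.
  by rewrite -[in LHS](setD1K et) loopE // sub_rem.
exists y; split=> // [s ys|t tT].
  by apply: yN; apply: contra ys => /and4P[-> -> _ ->].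
have [et|et] := boolP (e \in t); first by rewrite dyE.
have etT : e |: t \subset T by rewrite subUset sub1set eT.
have w_off f : f \in e |: t -> f != e -> (x - tdiff y) ((e |: t) :\ f) = 0.
  move=> _ fe; rewrite totalB dyE ?subrr //.
    exact: subset_trans (subsetDl _ _) etT.
  by rewrite !inE eq_sym fe eqxx.
have [St|St] := boolP (S \subset t); last first.
  rewrite x0 ?(negPf St) // tdiff_eq0 // => s st; apply: yN.
  by apply: contra St => /and4P[Ss _ _ _]; apply: subset_trans st.
have : tdiff (x - tdiff y) (e |: t) = 0.
  by rewrite raddfB /= tdiff_tdiff subr0 dx0.
rewrite (tdiff1 (setU11 e t)) // setU1K // => wt0.
apply/eqP; rewrite -subr_eq0 -totalB; apply/eqP.
(* The per-edge map from [t] to [e |: t] is injective, so the claim may be checked after applying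
   it. *)
apply: can_inj (fun z => fuse_eq_components z (esym (loopE t St))) _ _ _.
move/(congr1 (fun z => z *~ edge_sign (e |: t) e)): wt0.
by rewrite -mulrzA edge_sign_sqr mulr1z mul0rz fuse0 ?subsetUr.
Qed.

(** The bound on [#|S| + #|components S|] says that [S] is a forest. It survives the contraction of
    an edge joining two components, and at [S = T] it bounds the number of tensor factors. *)
Lemma bounds_on_exists n S T x : #|T :\: S| = n -> S \subset T ->
    (#|S| + #|components S| <= #|vertex G|)%N ->
  cocycle_on S T x -> exists y, bounds_on S T x y.
Proof.
elim: n S T x => [|n IH] S T x TS ST Sv xZ.
  have [xj x0 _] := xZ; exists 0; split=> [s|s|t tT].
  - by rewrite ffunE rpred0.
  - by rewrite ffunE.
  rewrite raddf0 ffunE.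
  have [/andP[St /eqP ti]|] := boolP ((S \subset t) && (#|t| == i)); last first.
    exact: x0.
  have tS : t = S.
    apply/eqP; rewrite eqEsubset St (subset_trans tT) // -setD_eq0.
    by rewrite -cards_eq0 TS.
  (* Here [t = S] has [i] edges, so there are at most [#|vertex G| - i] factors, too few for degree
     [j]. *)
  apply: tpow_deg_gt grd _ (xj t).
  rewrite card_sig -(ltn_add2l (d * i)) (leq_ltn_trans _ ij_gt) // -mulnDr.
  by rewrite leq_mul2l -ti tS Sv orbT.
have [e eTS] : exists e, e \in T :\: S by apply/card_gt0P; rewrite TS.
have /setDP[eT eS] := eTS.
have [loop|join] := boolP (connect (adjacent S) (ends e).1 (ends e).2).
  exact: bounds_on_loop eT eS ST loop xZ.
have [xj x0 dx0] := xZ.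
have TeT : T :\ e \subset T by exact: subsetDl.
have card_rem : #|(T :\ e) :\: S| = n.
  apply/eqP; rewrite -eqSS -TS (cardsD1 e (T :\: S)) eTS add1n eqSS.
  by rewrite !setDDl setUC.
have ST' : S \subset T :\ e by rewrite subsetD1 ST.
(* Deletion of [e]: this [y] bounds [x] on the subsets of [T] avoiding [e]. *)
have [|y [yj y0 xdy]] := IH S (T :\ e) x card_rem ST' Sv.
  split=> // [s sT|t tT]; first by apply: x0; apply: subset_trans TeT.
  by apply: dx0; apply: subset_trans TeT.
have dy0 t : ~~ ((S \subset t) && (#|t| == i)) -> tdiff y t = 0.
  move=> St; rewrite ffunE big1 // => f ft.
  rewrite y0 ?fuse0 ?subsetDl ?mul0rz //; apply: contra St.
  case/and3P=> Stf _; rewrite (cardsD1 f t) ft add1n => ->.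
  by rewrite (subset_trans Stf) ?subsetDl.
(* Contraction of [e]: the remainder [x - tdiff y] vanishes on the subsets of [T] avoiding [e],
   hence is a cocycle between [e |: S] and [T]. *)
have [||||z [zj z0 xdyz]] := IH (e |: S) T (x - tdiff y).
- by rewrite setUC -setDDl -card_rem !setDDl setUC.
- by rewrite subUset sub1set eT.
- rewrite cardsU1 eS add1n addSnnS.
  by apply: leq_trans Sv; rewrite leq_add2l card_components_join.
- split=> [s|s sT|t tT].
  + by rewrite totalB rpredB // tdiff_deg.
  + rewrite totalB subUset sub1set -andbA negb_and => /orP[es|Ss].
      by rewrite -xdy ?subrr // subsetD1 sT.
    by rewrite x0 // dy0 ?subrr.
  by rewrite raddfB /= tdiff_tdiff subr0 dx0.
exists (y + z); split=> [s|s|t tT].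
- by rewrite ffunE; apply: rpredD; [apply: yj | apply: zj].
- move=> yz; rewrite ffunE y0 ?z0 ?addr0 //; apply: contra yz => /and3P[].
    by rewrite subUset => /andP[_ ->] -> ->.
  by move=> -> sT ->; rewrite (subset_trans sT).
by rewrite raddfD ffunE -xdyz // totalB addrC subrK.
Qed.

End Exactness.

(** * Comparison of the total complex with the cochain groups *)

Section GradedPieces.
Variables (A : comPzRingType) (G : graph).
Local Notation E := 'I_(nedges G).

Definition cochain_restr k (y : total_cochain A G) : cochain A G k :=
  [ffun s : edge_sets G k => y (val s)].

(* [fuse s] is here the identity of [C^s], cast along [val s' = s]. *)
Definition cochain_ext k (x : cochain A G k) : total_cochain A G :=
  [ffun s : {set E} =>
     oapp (fun s' : edge_sets G k => fuse s (x s')) 0 (insub s)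
       : tpow A (component s)].

Lemma cochain_extK k : cancel (@cochain_ext k) (@cochain_restr k).
Proof.
move=> x; apply/ffunP=> s; rewrite !ffunE valK /=.
exact: fuse_id.
Qed.

Lemma cochain_ext0 k (x : cochain A G k) (s : {set E}) :
  #|s| != k -> cochain_ext x s = 0.
Proof. by move=> sk; rewrite ffunE insubN. Qed.

Lemma differential_restr k (y : total_cochain A G) (t : edge_sets G k.+1) :
  differential (cochain_restr k y) t = tdiff y (val t).
Proof.
rewrite !ffunE (exchange_big_dep (mem (val t))) /=; last first.
  by move=> s e _ /andP[_ /eqP->]; exact: setU11.
apply: eq_bigr => e et.
have te : #|val t :\ e| == k.
  by have := valP t; rewrite (cardsD1 e (val t)) (et : e \in _) add1n eqSS.
rewrite (big_pred1 (Sub (val t :\ e) te : edge_sets G k)) => [|s].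
  rewrite ffunE /=; congr (_ *~ (-1) ^+ _).
  (* One sign counts in [t :\ e], the other in [t]; they agree because [e] is not below itself. *)
  apply: eq_card => u; rewrite !inE; case: eqP => // ->.
  by rewrite ltnn !andbF.
rewrite inE; apply/andP/eqP=> [[es /eqP tE]|->]; last by rewrite /= setD11 setD1K.
by apply: val_inj; rewrite /= tE setU1K.
Qed.

End GradedPieces.

(** * From exactness to vanishing cohomology *)

Theorem theorem12 (m : nat) (hm : (1 <= m)%N)
  (A : comPzRingType) (gr : nat -> zmodClosed A)
  (hA : graded_algebra gr) (hdeg : degree_le gr (m - 1))
  (G : graph) (i j : nat) :
  (exists2 h : cohomology A G i, h \in cohomology_deg gr j & h != 0) ->
  ((m - 1) * i + j <= (m - 1) * #|vertex G|)%N.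
Proof.
case=> _ /asboolP[z /forallP zj ->]; apply: contraNT; rewrite -ltnNge => ij_gt.
pose x := cochain_ext (val z).
have xz : cochain_restr i x = val z by exact: cochain_extK.
have xZ : cocycle_on gr i j set0 setT x.
  split=> [s|s _|t _].
  - have [si|si] := boolP (#|s| == i); last by rewrite /x cochain_ext0 ?rpred0.
    by have := zj (Sub s si : edge_sets G i); rewrite -xz ffunE.
  - by rewrite sub0set; apply: cochain_ext0.
  have [ti|ti] := boolP (#|t| == i.+1).
    have := differential_restr x (Sub t ti : edge_sets G i.+1).
    rewrite xz /= => <-.
    by have := valP z; rewrite unfold_in => /eqP->; rewrite ffunE.
  (* For any other size of [t], no [t :\ e] has [i] elements, and [x] vanishes there. *)
  rewrite ffunE big1 // => e et; rewrite cochain_ext0.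
    by rewrite fuse0 ?subsetDl ?mul0rz.
  by rewrite (cardsD1 e) et in ti.
have card0 : (#|set0 : {set 'I_(nedges G)}| +
    #|components (G := G) set0| <= #|vertex G|)%N.
  by rewrite cards0 card_components.
have [y [_ y0 xdy]] :=
  bounds_on_exists hA hdeg ij_gt (erefl _) (sub0set _) card0 xZ.
(* With zero written as a class, the goal becomes membership in [coboundary]. *)
have pi0 : 0 = (\pi_(cohomology A G i) 0)%qT by rewrite raddf0.
rewrite {}pi0 -Quotient.idealrBE subr0.
have {xdy} zE s : val z s = tdiff y (val s).
  by rewrite -xz ffunE xdy // subsetT.
case: i z zE y0 {zj ij_gt x xz xZ} => [|k] z zE y0.
  (* For [i = 0] only zero is a coboundary, and [y] vanishes because [#|u|.+1 == 0] never holds. *)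
  apply/eqP/val_inj/ffunP=> s; rewrite zE (_ : y = 0) ?raddf0 ?ffunE //.
  by apply/ffunP=> u; rewrite y0 ?ffunE // !andbF.
apply/asboolP; exists (cochain_restr k y); apply/ffunP=> s.
by rewrite zE differential_restr.
Qed.
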